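(* Let $p\ge2$, $\lambda>0$ and $\beta=(\beta_1,\dots,\beta_p)$ with all $\beta_j>0$ and $\beta_\star:=\prod_{j=1}^p\beta_j>1$. Suppose that the random vector $Y=(Y_1,\dots,Y_p)$ has probability density function $$f(y_1,\dots,y_p)=C_0(\lambda;\beta)\Big(\prod_{j=1}^p\frac{y_j^{\lambda-1}e^{-\beta_jy_j}}{\Gamma(\lambda)}\Big)\,{}_0F_{p-1}(\lambda,\dots,\lambda;y_1\cdots y_p),\qquad y_1,\dots,y_p>0,$$ where $C_0(\lambda;\beta)=(\beta_\star-1)^\lambda$ is the normalizing constant (i.e. with this value $f$ integrates to $1$). Then the Laplace transform of $Y$ exists in a neighborhood of the origin and is of the form $$E\Big[\exp\Big(-\sum_{j=1}^p\eta_jY_j\Big)\Big]=\Big(\sum_{T\in\mathcal J}c_T\,\eta^T\Big)^{-\lambda}$$ for all sufficiently small $\eta_j>0$, $j=1,\dots,p$, with coefficient function $$c_T=\begin{cases}\dfrac{\beta^{\bar T}}{\beta_\star-1},&T\neq\emptyset,\\[2mm]1,&T=\emptyset.\end{cases}$$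
   Context: $\mathcal J$ is the collection of all subsets of $\{1,\dots,p\}$. For $s\in\mathbb R^p$ and $T\in\mathcal J$, $s^T:=\prod_{j\in T}s_j$ (with $s^\emptyset=1$), and $\bar T=\{1,\dots,p\}\setminus T$. The generalized hypergeometric series with $p-1$ lower parameters all equal to $\lambda$ is ${}_0F_{p-1}(\lambda,\dots,\lambda;z)=\sum_{k=0}^\infty\frac{z^k}{[(\lambda)_k]^{p-1}\,k!}$, where $(\lambda)_0=1$ and $(\lambda)_k=\lambda(\lambda+1)\cdots(\lambda+k-1)$. *)

(* Defs.v *)
From HB Require Import structures.
From mathcomp Require Import all_boot all_order all_algebra.
From mathcomp Require Import all_classical all_reals all_analysis.

Set Implicit Arguments.
Unset Strict Implicit.
Unset Printing Implicit Defensive.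

Import Order.TTheory GRing.Theory Num.Theory.
Import numFieldNormedType.Exports.

Local Open Scope classical_set_scope.
Local Open Scope ring_scope.

(* R^n is represented by n.-tuple R with the library's product sigma-algebra;
   its Lebesgue measure is built as an iterated product measure, transported
   along R * R^n -> R^(n+1). *)
Section lebesgue_cons.
Context {R : realType} (n : nat).
Variable m : {sigma_finite_measure set (n.-tuple R) -> \bar R}.
Local Open Scope ereal_scope.

Definition cons_tuple (x : R * n.-tuple R) : n.+1.-tuple R :=
  [tuple of x.1 :: x.2].

Lemma measurable_cons_tuple : measurable_fun [set: R * n.-tuple R] cons_tuple.
Proof. exact: (measurable_cons measurable_fst measurable_snd). Qed.

Lemma measurable_uncons_tuple :
  measurable_fun [set: n.+1.-tuple R]
    (fun t => (thead t, [tuple of behead t]) : R * n.-tuple R).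
Proof.
apply: measurable_fun_pair; first exact: (measurable_tnth ord0).
exact: measurable_behead.
Qed.

Definition lebesgue_cons : set (n.+1.-tuple R) -> \bar R :=
  pushforward (@lebesgue_measure R \x m) cons_tuple.

Let lebesgue_cons0 : lebesgue_cons set0 = 0.
Proof. by rewrite /lebesgue_cons /pushforward preimage_set0 measure0. Qed.

Let lebesgue_cons_ge0 A : 0 <= lebesgue_cons A.
Proof. by rewrite /lebesgue_cons /pushforward; exact: measure_ge0. Qed.

Let lebesgue_cons_sigma_additive : semi_sigma_additive lebesgue_cons.
Proof.
move=> F mF tF mUF; rewrite /lebesgue_cons /pushforward preimage_bigcup.
have mc A : measurable A -> measurable (cons_tuple @^-1` A).
  by move=> mA; rewrite -[X in measurable X]setTI; exact: measurable_cons_tuple.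
apply: measure_semi_sigma_additive.
- by move=> k; exact: mc.
- apply/trivIsetP => /= i j _ _ ij; rewrite -preimage_setI.
  by move/trivIsetP : tF => /(_ _ _ _ _ ij) ->//; rewrite preimage_set0.
- by rewrite -preimage_bigcup; exact: mc.
Qed.

HB.instance Definition _ := isMeasure.Build _ _ _
  lebesgue_cons lebesgue_cons0 lebesgue_cons_ge0 lebesgue_cons_sigma_additive.

Let lebesgue_cons_sigma_finite : sigma_finite setT lebesgue_cons.
Proof.
have /sigma_finiteP[F [FT ndF Foo]] := sigma_finiteT (@lebesgue_measure R).
have /sigma_finiteP[G [GT ndG Goo]] := sigma_finiteT m.
pose u (t : n.+1.-tuple R) : R * n.-tuple R := (thead t, [tuple of behead t]).
exists (fun k => u @^-1` (F k `*` G k)).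
  apply/seteqP; split => // t _.
  have [i _ Fi] : (\bigcup_k F k) (thead t) by rewrite -FT.
  have [j _ Gj] : (\bigcup_k G k) [tuple of behead t] by rewrite -GT.
  exists (maxn i j) => //; split.
  - by move: Fi; exact/subsetPset/ndF/leq_maxl.
  - by move: Gj; exact/subsetPset/ndG/leq_maxr.
move=> k; have [mFk Fkoo] := Foo k; have [mGk Gkoo] := Goo k; split.
  rewrite -[X in measurable X]setTI.
  by apply: measurable_uncons_tuple => //; exact: measurableX.
rewrite /lebesgue_cons /pushforward -comp_preimage.
rewrite (_ : u \o cons_tuple = id); last first.
  by apply/funext => -[x t]; congr pair; apply/val_inj.
by rewrite preimage_id product_measure1E// lte_mul_pinfty// ge0_fin_numE.
Qed.

HB.instance Definition _ := Measure_isSigmaFinite.Build _ _ _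
  lebesgue_cons lebesgue_cons_sigma_finite.

End lebesgue_cons.

Fixpoint lebesgue_tuple (R : realType) (n : nat) :
    {sigma_finite_measure set (n.-tuple R) -> \bar R} :=
  match n with
  | 0 => \d_([tuple] : 0.-tuple R)
  | n'.+1 => lebesgue_cons (lebesgue_tuple R n')
  end.

Lemma lebesgue_tuple_box (R : realType) (n : nat) (A : 'I_n -> set R) :
  (forall i, measurable (A i)) ->
  lebesgue_tuple R n [set t | forall i, A i (tnth t i)] =
  (\prod_(i < n) lebesgue_measure (A i))%E.
Proof.
elim: n A => [|n IHn] A mA.
  by rewrite big_ord0 /= diracE mem_set// => -[].
rewrite big_ord_recl/= /lebesgue_cons /pushforward.
set B := [set t : n.-tuple R | forall i, A (lift ord0 i) (tnth t i)].
have mB : measurable B.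
  rewrite (_ : B = \bigcap_(i in [set: 'I_n])
    ((@tnth n R)^~ i @^-1` A (lift ord0 i))); last first.
    by apply/seteqP; split => [t /= h i _|t /= h i]; exact: h.
  apply: fin_bigcap_measurable => [|i _]; first exact: finite_finset.
  by rewrite -[X in measurable X]setTI; exact: measurable_tnth.
rewrite -(IHn (fun i => A (lift ord0 i)))// -/B.
rewrite (_ : _ @^-1` _ = A ord0 `*` B).
  apply: product_measure1E => //.
  exact: mA.
apply/seteqP; split => -[x t] /=.
  move=> h; split; first exact: (h ord0).
  by move=> i; have := h (lift ord0 i); rewrite tnthS.
move=> [h0 h] i; case: (unliftP ord0 i) => [j ->|->//].
by rewrite tnthS; exact: h.
Qed.

Section density.
Context {R : realType} (n : nat).
Implicit Types f : n.-tuple R -> R.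

Definition is_pdf f :=
  [/\ measurable_fun [set: n.-tuple R] f, (forall y, 0 <= f y) &
      (\int[lebesgue_tuple R n]_y (f y)%:E = 1)%E].

Definition has_pdf d (Omega : measurableType d) (P : probability Omega R)
    (Y : {RV P >-> n.-tuple R}) f :=
  forall A, measurable A ->
    distribution P Y A = (\int[lebesgue_tuple R n]_(y in A) (f y)%:E)%E.

End density.

Section formulas.
Context {R : realType}.
Implicit Types (p : nat) (lambda x z : R).

Definition Gamma x : R :=
  \int[lebesgue_measure]_(t in `]0, +oo[) (t `^ (x - 1) * expR (- t)).

Definition pochhammer lambda (k : nat) : R := \prod_(i < k) (lambda + i%:R).

(* 0F_(p-1)(lambda, ..., lambda; z) *)
Definition hyp0F p lambda z : R :=
  limn (series (fun k => z ^+ k / (pochhammer lambda k ^+ p.-1 * k`!%:R))).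

Definition subset_prod p (s : 'I_p -> R) (T : {set 'I_p}) : R :=
  \prod_(j in T) s j.

Definition mgamma_pdf p lambda (beta : 'I_p -> R) (y : p.-tuple R) : R :=
  if [forall j, 0 < tnth y j] then
    (\prod_j beta j - 1) `^ lambda *
    (\prod_j (tnth y j `^ (lambda - 1) * expR (- (beta j * tnth y j))
              / Gamma lambda)) *
    hyp0F p lambda (\prod_j tnth y j)
  else 0.

Definition mgamma_coef p (beta : 'I_p -> R) (T : {set 'I_p}) : R :=
  if T == finset.set0 then 1
  else subset_prod beta (~: T)%SET / (\prod_j beta j - 1).

End formulas.

(* Main.v *)
Require Import Defs.
From mathcomp Require Import all_boot all_order all_algebra.
From mathcomp Require Import all_classical all_reals all_analysis.
From mathcomp Require Import measurable_realfun ring.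

Import Order.TTheory GRing.Theory Num.Theory.
Import numFieldNormedType.Exports.

Local Open Scope classical_set_scope.
Local Open Scope ring_scope.

(** The density is a positive mixture of products of one-variable gamma
    kernels. Expanding the hypergeometric factor,
      f(y) = (beta_star - 1)^lambda * sum_k m_k(y),
      m_k(y) = ((lambda)_k^(p-1) k!)^-1
               * prod_j y_j^(lambda+k-1) e^(-beta_j y_j) / Gamma(lambda),
    and multiplying m_k by exp(- sum_j eta_j y_j) merely replaces beta by
    b = beta + eta. All terms are nonnegative, so sum and integral may be
    exchanged and the integral of each product factorizes. As
    Gamma(lambda + k) = (lambda)_k Gamma(lambda), the integral of m_k is
      b_star^(- lambda) * (lambda)_k / k! * b_star^(-k),   b_star = prod_j b_j,
    and the binomial series gives
      b_star^(- lambda) (1 - 1/b_star)^(- lambda) = (b_star - 1)^(- lambda)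
    as soon as b_star > 1. This is [integral_mgamma_series]. The case
    eta = 0 says that f has mass 1. In general the Laplace transform is
    ((b_star - 1) / (beta_star - 1))^(- lambda), finite for every eta, of any
    sign, close enough to 0 for b_j > 0 and b_star > 1 to persist; expanding
    the product b_star over subsets yields the coefficients c_T
    ([sum_mgamma_coef]).

    The facts on Gamma are obtained in the extended reals, by exchanging
    nonnegative integrals and sums instead of integrating by parts at the
    singular endpoint 0:
    - dilation of Lebesgue measure gives
      int t^(x-1) e^(-bt) dt = b^(-x) Gamma(x);
    - integrating this identity, taken at x + 1, over b in [1, +oo[ gives
      Gamma(x+1) / x = Gamma(x);
    - expanding e^(ut) in int t^(x-1) e^(-(1-u)t) dt gives the binomial
      series. *)

(** * The gamma integral *)

(** The dilated Lebesgue measure, renormalized, agrees with Lebesgue measure on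
    half-open intervals, hence everywhere. Being stated for measures, the change
    of variables tolerates the singularity of the gamma kernel at 0. *)
Lemma ge0_integral_scale {R : realType} (c : R)
    (f : measurableTypeR R -> \bar R) : 0 < c ->
  measurable_fun setT f -> (forall t, 0 <= f t)%E ->
  (\int[lebesgue_measure]_t f (c * t)%R
   = c^-1%:E * \int[lebesgue_measure]_t f t)%E.
Proof.
move=> c0 mf f0.
pose phi : measurableTypeR R -> measurableTypeR R := fun t => c * t.
have mphi : measurable_fun setT phi by exact: mulrl_measurable.
pose dilated := mscale (NngNum (ltW c0)) (@lebesgue_measure R).
transitivity (c^-1%:E * \int[pushforward dilated phi]_t f t)%E.
  rewrite ge0_integral_pushforward//= preimage_setT.
  rewrite ge0_integral_mscale//=; last exact: measurableT_comp.
  by rewrite muleA -EFinM mulVf ?gt_eqF// mul1e.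
congr (_ * _)%E; apply/esym/eq_measure_integral => // A mA _.
apply: lebesgue_measure_unique mA => _ [[a b] _ <-] /=.
rewrite /pushforward /dilated /mscale/=.
have -> : phi @^-1` `]a, b] = `]c^-1 * a, c^-1 * b]%classic.
  apply/seteqP; split => t /=; rewrite !in_itv/= /phi => /andP[ab bt];
    apply/andP; split.
  - by rewrite ltr_pdivrMl.
  - by rewrite ler_pdivlMl.
  - by rewrite -ltr_pdivrMl.
  - by rewrite -ler_pdivlMl.
rewrite !lebesgue_measure_itv/= !lte_fin ltr_pM2l ?invr_gt0//.
case: ifPn => _; last by rewrite mule0.
by rewrite -!EFinB -EFinM; congr EFin; field; rewrite gt_eqF.
Qed.

Lemma gt0_powRD {R : realType} (a x y : R) : 0 < a ->
  a `^ (x + y) = a `^ x * a `^ y.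
Proof. by move=> a0; rewrite powRD// (gt_eqF a0) implybT. Qed.

(** Extending the integrand by 0 to the whole line keeps every integral below
    over the full space, where Tonelli and product integrals apply. *)
Definition gamma_kernel {R : realType} (x b t : R) : R :=
  if 0 < t then t `^ (x - 1) * expR (- (b * t)) else 0.

Lemma gamma_kernel_ge0 {R : realType} (x b t : R) : 0 <= gamma_kernel x b t.
Proof.
rewrite /gamma_kernel; case: ifP => // _.
by rewrite mulr_ge0 ?powR_ge0 ?expR_ge0.
Qed.

Lemma measurable_gamma_kernel2 {R : realType} (x : R) :
  measurable_fun [set: R * R] (fun z => gamma_kernel x z.1 z.2).
Proof.
apply: measurable_fun_ifT => //=; first exact: measurable_fun_ltr.
apply: measurable_funM.
  exact: (measurableT_comp (measurable_powR (x - 1)) measurable_snd).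
apply: measurableT_comp => //; apply: measurableT_comp => //.
exact: measurable_funM.
Qed.

Lemma measurable_gamma_kernel {R : realType} (x b : R) :
  measurable_fun [set: R] (gamma_kernel x b).
Proof.
exact: (measurableT_comp (measurable_gamma_kernel2 x) (pair1_measurable b)).
Qed.

Lemma integral_gamma_kernel_scale {R : realType} (x b : R) : 0 < b ->
  (\int[lebesgue_measure]_t (gamma_kernel x b t)%:E =
   (b `^ (- x))%:E * \int[lebesgue_measure]_t (gamma_kernel x 1 t)%:E)%E.
Proof.
move=> b0.
transitivity (\int[lebesgue_measure]_t
    ((b `^ (1 - x))%:E * (gamma_kernel x 1 (b * t))%:E))%E.
  apply: eq_integral => t _; rewrite -EFinM; congr EFin.
  rewrite /gamma_kernel pmulr_rgt0//.
  case: ifPn => t0; last by rewrite mulr0.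
  rewrite mul1r powRM ?ltW// !mulrA -gt0_powRD//.
  by rewrite (_ : 1 - x + (x - 1) = 0) ?powRr0 ?mul1r//; ring.
rewrite ge0_integralZl//=; last 3 first.
- apply/measurable_EFinP; apply: measurableT_comp; last exact: mulrl_measurable.
  exact: measurable_gamma_kernel.
- by move=> t _; rewrite lee_fin gamma_kernel_ge0.
- by rewrite lee_fin powR_ge0.
rewrite (ge0_integral_scale _ (fun t => (gamma_kernel x 1 t)%:E))//;
  last 2 first.
- by apply/measurable_EFinP; exact: measurable_gamma_kernel.
- by move=> t; rewrite lee_fin gamma_kernel_ge0.
rewrite muleA -EFinM; congr (_%:E * _)%E.
rewrite -powR_inv1 ?ltW// -gt0_powRD//.
by congr powR; ring.
Qed.

Lemma integral_itvy_expR {R : realType} (a t : R) : 0 < t ->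
  (\int[lebesgue_measure]_(b in `[a, +oo[) (t * expR (- (b * t)))%:E
   = (expR (- (a * t)))%:E)%E.
Proof.
move=> t0.
pose F b := - expR (- (b * t)).
have dF (b : R) : is_derive b (1 : R) F (t * expR (- (b * t))).
  rewrite /F; apply: is_derive_eq.
  by rewrite /GRing.scale/=; ring.
have cf : continuous (fun b : R => t * expR (- (b * t)) : R).
  move=> b; apply: cvgM; first exact: cvg_cst.
  apply: continuous_comp; last exact: continuous_expR.
  by apply: cvgN; apply: cvgM; [exact: cvg_id|exact: cvg_cst].
rewrite (@ge0_continuous_FTC2y _ _ F _ 0)//.
- by rewrite /F EFinN oppeK add0e.
- by move=> b _; rewrite mulr_ge0 ?expR_ge0 ?ltW.
- by apply: continuous_subspaceT.
- rewrite -oppr0; apply: cvgN.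
  apply: (@cvg_comp _ _ _ _ (fun u => expR (- u)) _ (pinfty_nbhs R)).
    exact: gt0_cvgMly.
  exact: cvgr_expR.
- apply: cvg_at_right_filter; apply: differentiable_continuous.
  exact/derivable1_diffP.
- by move=> b _; rewrite derive1E derive_val.
Qed.

Lemma integral_itvy_powR {R : realType} (x : R) : 0 < x ->
  (\int[lebesgue_measure]_(b in `[1%R, +oo[) (b `^ (- (x + 1)))%:E
   = x^-1%:E)%E.
Proof.
move=> x0.
pose F b := - x^-1 * b `^ (- x).
have dF (b : R) : 0 < b -> is_derive b (1 : R) F (b `^ (- (x + 1))).
  move=> b0; rewrite /F.
  have := is_derive1_powR (- x) b0 => ?.
  apply: is_derive_eq.
  rewrite /GRing.scale/= mulrA mulrNN mulVf ?gt_eqF// mul1r.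
  by congr powR; ring.
rewrite (@ge0_continuous_FTC2y _ _ F _ 0)//.
- by rewrite /F powR1 mulr1 EFinN oppeK add0e.
- by move=> b _; exact: powR_ge0.
- apply: derivable_within_continuous => b; rewrite in_itv/= andbT => b1.
  by apply: derivable_powR; rewrite in_itv/= andbT (lt_le_trans _ b1).
- rewrite -(mulr0 (- x^-1)); apply: cvgM; first exact: cvg_cst.
  apply: (@cvg_trans _ (expR (- (ln b * x)) @[b --> +oo])).
    apply: near_eq_cvg; near=> b; rewrite /powR gt_eqF; last first.
      by near: b; exact: nbhs_pinfty_gt.
    by rewrite mulNr mulrC.
  apply: (@cvg_comp _ _ _ _ (fun u => expR (- u)) _ (pinfty_nbhs R)).
    apply: gt0_cvgMly => //.
    apply/cvgryPge => A; near=> b.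
    rewrite -ler_expR lnK; last first.
      by rewrite posrE; near: b; exact: nbhs_pinfty_gt.
    by near: b; apply: nbhs_pinfty_ge; exact: num_real.
  exact: cvgr_expR.
- by move=> b b1; have ? := dF b (lt_trans ltr01 b1); exact: ex_derive.
- apply: cvg_at_right_filter; apply: differentiable_continuous.
  by apply/derivable1_diffP; have ? := dF 1 ltr01; exact: ex_derive.
- move=> b; rewrite in_itv/= andbT => b1.
  by rewrite derive1E; have ? := dF b (lt_trans ltr01 b1); rewrite derive_val.
Unshelve. all: end_near. Qed.

(** The functional equation Gamma(x+1) = x Gamma(x), still in the extended
    reals. Integrate t^x e^(-bt) over t and over b in [1, +oo[: doing t first
    gives Gamma(x+1) times the integral of b^(-x-1), that is Gamma(x+1) / x;
    doing b first gives Gamma(x). No finiteness is presupposed, so that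
    finiteness can be deduced from it. *)
Lemma integral_gamma_kernelS {R : realType} (x : R) : 0 < x ->
  (\int[lebesgue_measure]_t (gamma_kernel (x + 1) 1 t)%:E =
   x%:E * \int[lebesgue_measure]_t (gamma_kernel x 1 t)%:E)%E.
Proof.
move=> x0.
pose mu : {sigma_finite_measure set (measurableTypeR R) -> \bar R} :=
  lebesgue_measure.
pose h (z : R * R) : R :=
  if 1 <= z.1 then gamma_kernel (x + 1) z.1 z.2 else 0.
have h0 z : 0 <= h z by rewrite /h; case: ifP => // _; exact: gamma_kernel_ge0.
have mh : measurable_fun [set: measurableTypeR R * measurableTypeR R] h.
  apply: measurable_fun_ifT => //=; last exact: measurable_gamma_kernel2.
  exact: measurable_fun_ler.
have I0 b : (0 <= \int[mu]_t (gamma_kernel (x + 1) b t)%:E)%E.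
  by apply: integral_ge0 => t _; rewrite lee_fin gamma_kernel_ge0.
have E1 : (\int[mu]_b \int[mu]_t (h (b, t))%:E =
    x^-1%:E * \int[mu]_t (gamma_kernel (x + 1) 1 t)%:E)%E.
  transitivity (\int[mu]_(b in `[1%R, +oo[) ((b `^ (- (x + 1)))%:E *
      \int[mu]_t (gamma_kernel (x + 1) 1 t)%:E))%E.
    rewrite [RHS]integral_mkcond; apply: eq_integral => b _.
    rewrite patchE mem_setE/= in_itv/= andbT /h/=; case: ifPn => b1.
      by rewrite integral_gamma_kernel_scale// (lt_le_trans _ b1).
    by rewrite integral0.
  rewrite ge0_integralZr//=; first by rewrite integral_itvy_powR.
  - by apply/measurable_EFinP; apply: measurable_funTS; exact: measurable_powR.
  - by move=> b _; rewrite lee_fin powR_ge0.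
have E2 : (\int[mu]_t \int[mu]_b (h (b, t))%:E =
    \int[mu]_t (gamma_kernel x 1 t)%:E)%E.
  apply: eq_integral => t _.
  transitivity (\int[mu]_(b in `[1%R, +oo[) (gamma_kernel (x + 1) b t)%:E)%E.
    rewrite [RHS]integral_mkcond; apply: eq_integral => b _.
    by rewrite patchE mem_setE/= in_itv/= andbT /h/=; case: ifPn.
  rewrite /gamma_kernel; case: ifPn => t0; last by rewrite integral0.
  rewrite EFinM -(integral_itvy_expR 1 _ t0) -ge0_integralZl//=.
  - apply: eq_integral => b _; rewrite -EFinM mulrA addrK.
    by rewrite [_ `^ _ * t]mulrC mulr_powRB1// ltW.
  - apply/measurable_EFinP/measurable_funTS; apply: measurable_funM => //.
    do 2 apply: measurableT_comp => //; exact: measurable_funM.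
  - by move=> b _; rewrite lee_fin mulr_ge0 ?ltW// expR_gt0.
  - by rewrite lee_fin powR_ge0.
have E12 := @fubini_tonelli _ _ _ _ _ mu mu (fun z => (h z)%:E).
rewrite E1 E2 in E12; rewrite -E12; last 2 first.
- by apply/measurable_EFinP; exact: mh.
- by move=> z; rewrite lee_fin.
by rewrite muleA -EFinM mulfV ?gt_eqF// mul1e.
Qed.

Lemma integral_gamma_kernel_nat {R : realType} (n : nat) :
  (\int[lebesgue_measure]_t (gamma_kernel (n%:R + 1) 1 t)%:E =
   (n`!%:R : R)%:E)%E.
Proof.
elim: n => [|n IHn]; last first.
  rewrite integral_gamma_kernelS// -natr1 IHn -EFinM factS natrM.
  by rewrite natr1.
transitivity (\int[lebesgue_measure]_(t in `]0%R, +oo[)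
    (1 * expR (- (t * 1)) : R)%:E)%E.
  rewrite [RHS]integral_mkcond; apply: eq_integral => t _.
  rewrite patchE mem_setE/= in_itv/= andbT /gamma_kernel; case: ifPn => // _.
  by rewrite addrK powRr0 !mul1r mulr1.
rewrite integral_itv_obnd_cbnd; last first.
  apply/measurable_EFinP/measurable_funTS; apply: measurable_funM => //.
  do 2 apply: measurableT_comp => //; exact: measurable_funM.
by rewrite integral_itvy_expR// mul0r oppr0 expR0.
Qed.

(** By the functional equation it suffices to bound Gamma(x+1), whose
    integrand satisfies t^x <= 1 + t^n for n >= x. *)
Lemma integral_gamma_kernel_lty {R : realType} (x : R) : 0 < x ->
  (\int[lebesgue_measure]_t (gamma_kernel x 1 t)%:E < +oo)%E.
Proof.
move=> x0; have [n xn] : exists n, x <= n%:R.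
  by exists (Num.truncn x).+1; exact/ltW/truncnS_gt.
suff : (\int[lebesgue_measure]_t (gamma_kernel (x + 1) 1 t)%:E < +oo)%E.
  rewrite integral_gamma_kernelS//; move: (\int[_]_t _)%E => [r _|/=|//].
    exact: ltry.
  by rewrite gt0_muley ?lte_fin.
have mk (y : R) : measurable_fun setT (fun t => (gamma_kernel y 1 t)%:E).
  by apply/measurable_EFinP; exact: measurable_gamma_kernel.
have k0 (y t : R) : (0 <= (gamma_kernel y 1 t)%:E)%E.
  by rewrite lee_fin gamma_kernel_ge0.
apply: (@le_lt_trans _ _ (\int[lebesgue_measure]_t
    ((gamma_kernel (0 + 1) 1 t)%:E + (gamma_kernel (n%:R + 1) 1 t)%:E))%E).
  apply: ge0_le_integral => //=.
  - exact: mk.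
  - by apply: emeasurable_funD; exact: mk.
  move=> t _; rewrite -EFinD lee_fin /gamma_kernel; case: ifPn => t0;
    last by rewrite addr0.
  rewrite -mulrDl ler_wpM2r ?expR_ge0// !addrK powRr0.
  have [t1|/ltW t1] := leP 1 t.
    by rewrite ler_wpDl// ler_powR.
  rewrite ler_wpDr ?powR_ge0//.
  by rewrite -(powRr0 t) ger_powR// ?t0 ?t1// ltW.
rewrite ge0_integralD//=; try exact: mk.
by rewrite (integral_gamma_kernel_nat 0) integral_gamma_kernel_nat -EFinD ltry.
Qed.

Lemma EFin_Gamma {R : realType} (x : R) : 0 < x ->
  (\int[lebesgue_measure]_t (gamma_kernel x 1 t)%:E = (Gamma x)%:E)%E.
Proof.
move=> x0; rewrite /Gamma /Rintegral.
have -> : (\int[lebesgue_measure]_(t in `]0%R, +oo[)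
    (t `^ (x - 1) * expR (- t))%:E)%E
    = (\int[lebesgue_measure]_t (gamma_kernel x 1 t)%:E)%E.
  rewrite [LHS]integral_mkcond; apply: eq_integral => t _.
  by rewrite patchE mem_setE/= in_itv/= andbT /gamma_kernel mul1r; case: ifPn.
rewrite fineK// ge0_fin_numE ?integral_gamma_kernel_lty//.
by apply: integral_ge0 => t _; rewrite lee_fin gamma_kernel_ge0.
Qed.

(** The kernel is positive on ]0, +oo[, which is not a null set. *)
Lemma Gamma_gt0 {R : realType} (x : R) : 0 < x -> 0 < Gamma x.
Proof.
move=> x0; rewrite -lte_fin -EFin_Gamma// lt0e integral_ge0 ?andbT; last first.
  by move=> t _; rewrite lee_fin gamma_kernel_ge0.
apply/eqP => I0.
have : ae_eq lebesgue_measure setT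
    (fun t : measurableTypeR R => (gamma_kernel x 1 t)%:E) (cst 0%E).
  apply/ae_eq_integral_abs => //.
    by apply/measurable_EFinP; exact: measurable_gamma_kernel.
  rewrite -[RHS]I0; apply: eq_integral => t _.
  by rewrite gee0_abs// lee_fin gamma_kernel_ge0.
move=> [N [mN N0 subN]].
suff : (lebesgue_measure `]0%R, +oo[%classic <= lebesgue_measure N)%E.
  by rewrite N0 lebesgue_measure_itv/= ltry leye_eq.
apply: le_measure; rewrite ?inE//.
move=> t /=; rewrite in_itv/= andbT => t0; apply: subN => /= /(_ Logic.I).
rewrite /gamma_kernel t0 => -[] /eqP; rewrite gt_eqF//.
by rewrite mulr_gt0 ?powR_gt0 ?expR_gt0.
Qed.

Lemma integral_gamma_kernel {R : realType} (x b : R) : 0 < x -> 0 < b ->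
  (\int[lebesgue_measure]_t (gamma_kernel x b t)%:E
   = (b `^ (- x) * Gamma x)%:E)%E.
Proof. by move=> x0 b0; rewrite integral_gamma_kernel_scale// EFin_Gamma. Qed.

Lemma Gamma_pochhammer {R : realType} (x : R) (k : nat) : 0 < x ->
  Gamma (x + k%:R) = pochhammer x k * Gamma x.
Proof.
move=> x0; elim: k => [|k IHk].
  by rewrite addr0 /pochhammer big_ord0 mul1r.
have xk : 0 < x + k%:R by rewrite ltr_wpDr.
apply: EFin_inj; rewrite -natr1 addrA -EFin_Gamma; last exact: addr_gt0.
rewrite integral_gamma_kernelS// EFin_Gamma// -EFinM IHk.
by rewrite /pochhammer big_ord_recr/= mulrCA mulrA.
Qed.

(** * Product integrals on tuples *)

Lemma measurable_prod_tnth {R : realType} (n : nat) (g : 'I_n -> R -> R) :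
  (forall i, measurable_fun [set: R] (g i)) ->
  measurable_fun [set: n.-tuple R] (fun y => \prod_(i < n) g i (tnth y i)).
Proof.
move=> mg; apply: measurable_prod => i _.
by apply: measurableT_comp => //; exact: measurable_tnth.
Qed.

(** Tonelli, peeling off one coordinate at a time. *)
Lemma integral_lebesgue_tuple_prod {R : realType} (n : nat)
    (g : 'I_n -> R -> R) :
  (forall i, measurable_fun [set: R] (g i)) -> (forall i t, 0 <= g i t) ->
  (\int[lebesgue_tuple R n]_y (\prod_(i < n) g i (tnth y i))%:E
   = \prod_(i < n) \int[lebesgue_measure]_t (g i t)%:E)%E.
Proof.
elim: n g => [|n IHn] g mg g0.
  rewrite big_ord0 /=.
  rewrite integral_dirac//=; last first.
    by apply/measurable_EFinP; exact: measurable_prod_tnth.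
  by rewrite diracE in_setT mul1e big_ord0.
have mprod := measurable_prod_tnth n.+1 g mg.
have mprod' :=
  measurable_prod_tnth n (fun i => g (lift ord0 i)) (fun i => mg _).
rewrite /= /lebesgue_cons ge0_integral_pushforward//=; last 3 first.
- exact: measurable_cons_tuple.
- exact/measurable_EFinP.
- by move=> y _; rewrite lee_fin prodr_ge0.
rewrite preimage_setT fubini_tonelli1/=; last 2 first.
- apply/measurable_EFinP; apply: (measurableT_comp mprod).
  exact: measurable_cons_tuple.
- by move=> y; rewrite lee_fin prodr_ge0.
rewrite big_ord_recl -IHn// -ge0_integralZr//=; last 3 first.
- by apply/measurable_EFinP; exact: mg.
- by move=> t _; rewrite lee_fin.
- by apply: integral_ge0 => y _; rewrite lee_fin prodr_ge0.
apply: eq_integral => t _; rewrite /fubini_F -ge0_integralZl//=; last 3 first.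
- by apply/measurable_EFinP; exact: mprod'.
- by move=> y _; rewrite lee_fin prodr_ge0.
- by rewrite lee_fin.
apply: eq_integral => y _; rewrite -EFinM big_ord_recl; congr (_ * _)%:E.
by apply: eq_bigr => i _; rewrite tnthS.
Qed.

(** * Nonnegative power series *)

Lemma nneseries_EFin {R : realType} (a : R^nat) : cvgn (series a) ->
  (\sum_(0 <= k <oo) (a k)%:E = (limn (series a))%:E)%E.
Proof.
move=> cva; rewrite -EFin_lim//; apply: congr_lim.
by apply/funext => n /=; rewrite sumEFin.
Qed.

Lemma nneseries_expR {R : realType} (z : R) :
  (\sum_(0 <= k <oo) (z ^+ k / k`!%:R)%:E = (expR z)%:E)%E.
Proof. by rewrite nneseries_EFin//; exact: is_cvg_series_exp_coeff. Qed.

Lemma pochhammer_gt0 {R : realType} (x : R) (k : nat) :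
  0 < x -> 0 < pochhammer x k.
Proof. by move=> x0; apply: prodr_gt0 => i _; rewrite ltr_wpDr. Qed.

(** After multiplication by Gamma(x), the k-th term is the integral of
    t^(x+k-1) e^(-t) u^k / k!; under the integral sign these sum to
    t^(x-1) e^(-(1-u)t), the kernel with parameter 1 - u. *)
Lemma nneseries_binomial {R : realType} (x u : R) : 0 < x -> 0 <= u < 1 ->
  (\sum_(0 <= k <oo) (pochhammer x k / k`!%:R * u ^+ k)%:E
   = ((1 - u) `^ (- x))%:E)%E.
Proof.
move=> x0 /andP[u0 u1]; have G0 := Gamma_gt0 x x0.
have c0 k : 0 <= u ^+ k / k`!%:R by rewrite divr_ge0 ?exprn_ge0.
have mk (y b : R) : measurable_fun setT (fun t => (gamma_kernel y b t)%:E).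
  by apply/measurable_EFinP; exact: measurable_gamma_kernel.
(* both sides may be compared after multiplication by Gamma x *)
have GK (y : \bar R) : y = ((Gamma x)^-1%:E * ((Gamma x)%:E * y))%E.
  by rewrite muleA -EFinM mulVf ?gt_eqF// mul1e.
rewrite [LHS]GK [RHS]GK; congr (_ * _)%E.
rewrite -nneseriesZl; last first.
  move=> k _; rewrite lee_fin mulr_ge0 ?exprn_ge0// divr_ge0//.
  exact/ltW/pochhammer_gt0.
rewrite -EFinM mulrC -integral_gamma_kernel ?subr_gt0//.
transitivity (\sum_(0 <= k <oo) \int[lebesgue_measure]_t
    ((u ^+ k / k`!%:R)%:E * (gamma_kernel (x + k%:R) 1 t)%:E))%E.
  apply: eq_eseriesr => k _; rewrite ge0_integralZl/=; last 4 first.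
  - by [].
  - exact: mk.
  - by move=> t _; rewrite lee_fin gamma_kernel_ge0.
  - by rewrite lee_fin.
  rewrite EFin_Gamma ?Gamma_pochhammer// ?ltr_wpDr// -!EFinM.
  by congr _%:E; ring.
rewrite -integral_nneseries//=; last 2 first.
- by move=> k; apply: emeasurable_funM => //; exact: mk.
- by move=> k t _; rewrite -EFinM lee_fin mulr_ge0 ?gamma_kernel_ge0.
apply: eq_integral => t _; rewrite /gamma_kernel; case: ifPn => t0; last first.
  by rewrite eseries0// => k _ _; rewrite mule0.
rewrite (_ : - ((1 - u) * t) = u * t - 1 * t); last by ring.
rewrite expRD [expR (u * t) * _]mulrC mulrA EFinM -nneseries_expR -nneseriesZl.
  apply: eq_eseriesr => k _; rewrite -!EFinM; congr _%:E.
  rewrite (_ : x + k%:R - 1 = x - 1 + k%:R); last by ring.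
  by rewrite gt0_powRD// powR_mulrn ?ltW// exprMn; ring.
by move=> k _; rewrite lee_fin divr_ge0// exprn_ge0// mulr_ge0// ltW.
Qed.

(** (x)_k is bounded below by min(1, x), as its factors other than the first
    are at least 1; hence domination by a multiple of the exponential series. *)
Lemma is_cvg_series_hyp0F {R : realType} (p : nat) (x z : R) :
  0 < x -> 0 <= z ->
  cvgn (series (fun k => z ^+ k / (pochhammer x k ^+ p * k`!%:R))).
Proof.
move=> x0 z0; pose c := Num.min 1 x.
have c_gt0 : 0 < c by rewrite lt_min ltr01.
have poch_ge k : c <= pochhammer x k.
  case: k => [|k]; first by rewrite /pochhammer big_ord0 ge_min lexx.
  rewrite /pochhammer big_ord_recl/= addr0 ge_min; apply/orP; right.
  apply: ler_peMr; first exact: ltW.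
  elim/big_ind: _ => //= [a b a1 b1|i _]; first exact: mulr_ege1.
  by apply: ler_wpDl; [exact: ltW|rewrite ler1n].
apply: (@series_le_cvg _ _ (fun k => (c ^+ p)^-1 * exp_coeff z k)).
- move=> k; rewrite divr_ge0 ?exprn_ge0// mulr_ge0// exprn_ge0//.
  exact/ltW/pochhammer_gt0.
- by move=> k; rewrite mulr_ge0 ?exp_coeff_ge0// invr_ge0 exprn_ge0// ltW.
- move=> k; rewrite invfM mulrCA ler_wpM2r//.
    exact: exp_coeff_ge0.
  rewrite lef_pV2 ?posrE ?exprn_gt0 ?pochhammer_gt0//.
  apply: lerXn2r => //; rewrite nnegrE ltW//.
  exact: pochhammer_gt0.
- exact/is_cvg_seriesZ/is_cvg_series_exp_coeff.
Qed.

(** * Integration against a density *)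

Section density.
Import HBNNSimple.
Local Open Scope ereal_scope.

(** The defining formula of nu is the case of an indicator function; linearity
    and monotone convergence do the rest. *)
Lemma ge0_integral_density d {T : measurableType d} {R : realType}
    (mu nu : {measure set T -> \bar R}) (f : T -> R) (g : T -> \bar R) :
  measurable_fun [set: T] f -> (forall x, 0 <= f x)%R ->
  (forall A, measurable A -> nu A = \int[mu]_(x in A) (f x)%:E) ->
  measurable_fun [set: T] g -> (forall x, 0 <= g x) ->
  \int[nu]_x g x = \int[mu]_x (g x * (f x)%:E).
Proof.
move=> mf f0 nuE mg g0.
have mEf : measurable_fun [set: T] (EFin \o f) by exact/measurable_EFinP.
have f0E x : 0 <= (f x)%:E by rewrite lee_fin.
have Hnn (h : {nnsfun T >-> R}) :
    \int[nu]_x (h x)%:E = \int[mu]_x ((h x)%:E * (f x)%:E).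
  rewrite integralT_nnsfun sintegralE.
  have m1 y : measurable (h @^-1` [set y]) by exact: measurable_funPTI.
  transitivity (\int[mu]_x (\sum_(y \in range h)
      ((y * \1_(h @^-1` [set y]) x)%:E * (f x)%:E))).
    rewrite ge0_integral_fsum//; last 2 first.
    - move=> y; apply: emeasurable_funM => //.
      apply/measurable_EFinP; exact: measurable_funM.
    - by move=> y x _; rewrite mule_ge0// nnfun_muleindic_ge0.
    apply: eq_fsbigr => y; rewrite inE => -[x _ <-].
    under eq_integral do rewrite EFinM -muleA.
    rewrite ge0_integralZl//.
    - congr (_ * _); rewrite nuE// integral_mkcond; apply: eq_integral => z _.
      by rewrite patchE indicE; case: ifPn => _; rewrite ?mul1e ?mul0e.
    - by apply: emeasurable_funM => //; exact/measurable_EFinP.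
    - by move=> z _; rewrite mule_ge0// lee_fin.
    - by rewrite lee_fin.
  apply: eq_integral => x _.
  rewrite -ge0_mule_fsuml ?fsumEFin// -?fimfunE// => y.
  exact: nnfun_muleindic_ge0.
pose h := nnsfun_approx measurableT mg.
transitivity (limn (fun n => \int[nu]_x (h n x)%:E)).
  rewrite -monotone_convergence//.
  - apply: eq_integral => x _; apply/esym/cvg_lim => //.
    exact: cvg_nnsfun_approx.
  - by move=> n; exact/measurable_EFinP.
  - by move=> n x _; rewrite lee_fin.
  - by move=> x _ m n mn; rewrite lee_fin; exact/lefP/nd_nnsfun_approx.
under eq_fun do rewrite Hnn.
rewrite -monotone_convergence//.
- apply: eq_integral => x _; apply/cvg_lim => //; apply: cvgeZr => //.
  exact: cvg_nnsfun_approx.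
- by move=> n; apply: emeasurable_funM => //; exact/measurable_EFinP.
- by move=> n x _; rewrite mule_ge0 ?lee_fin.
- move=> x _ m n mn; rewrite lee_wpmul2r// lee_fin.
  exact/lefP/nd_nnsfun_approx.
Qed.
End density.

(** * The density as a mixture of gamma products *)

Lemma prod_powR {R : realType} (I : finType) (b : I -> R) (x : R) :
  (forall i, 0 <= b i) -> \prod_i b i `^ x = (\prod_i b i) `^ x.
Proof.
move=> b0.
suff [] : \prod_i b i `^ x = (\prod_i b i) `^ x /\ 0 <= \prod_i b i by [].
elim/big_rec2: _ => [|i u v _ [-> v0]]; first by rewrite powR1.
by rewrite powRM// mulr_ge0.
Qed.

(** The summands m_k of the mixture, normalizing constant excluded so that
    tilting by an exponential only changes the rates b. *)
Definition mgamma_term {R : realType} {p : nat} (lambda : R) (b : 'I_p -> R)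
    (k : nat) (y : p.-tuple R) : R :=
  (pochhammer lambda k ^+ p.-1 * k`!%:R)^-1 *
  \prod_(j < p) (gamma_kernel (lambda + k%:R) (b j) (tnth y j) / Gamma lambda).

Lemma measurable_mgamma_term {R : realType} {p : nat} (lambda : R)
    (b : 'I_p -> R) (k : nat) :
  measurable_fun [set: p.-tuple R] (mgamma_term lambda b k).
Proof.
apply: measurable_funM => //.
apply: (measurable_prod_tnth p
  (fun j t => gamma_kernel (lambda + k%:R) (b j) t / Gamma lambda)) => j.
by apply: measurable_funM => //; exact: measurable_gamma_kernel.
Qed.

Lemma mgamma_term_ge0 {R : realType} {p : nat} (lambda : R)
    (b : 'I_p -> R) (k : nat) (y : p.-tuple R) : 0 < lambda ->
  0 <= mgamma_term lambda b k y.
Proof.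
move=> l0.
have P0 := pochhammer_gt0 lambda k l0; have G0 := Gamma_gt0 lambda l0.
apply: mulr_ge0; first by rewrite invr_ge0 mulr_ge0// exprn_ge0// ltW.
by apply: prodr_ge0 => j _; rewrite divr_ge0 ?gamma_kernel_ge0// ltW.
Qed.

Lemma expR_mgamma_term {R : realType} {p : nat} (lambda : R)
    (b eta : 'I_p -> R) (k : nat) (y : p.-tuple R) :
  expR (- \sum_j eta j * tnth y j) * mgamma_term lambda b k y =
  mgamma_term lambda (fun j => b j + eta j) k y.
Proof.
rewrite /mgamma_term mulrCA; congr (_ * _).
rewrite -sumrN expR_sum -big_split/=; apply: eq_bigr => j _.
rewrite mulrA; congr (_ / _); rewrite /gamma_kernel.
case: ifPn => _; last by rewrite mulr0.
by rewrite mulrCA -expRD; congr (_ * expR _); ring.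
Qed.

Lemma mgamma_pdf_series {R : realType} {p : nat} (lambda : R)
    (b : 'I_p -> R) (y : p.-tuple R) : 0 < lambda ->
  ((mgamma_pdf lambda b y)%:E = ((\prod_j b j - 1) `^ lambda)%:E *
    \sum_(0 <= k <oo) (mgamma_term lambda b k y)%:E)%E.
Proof.
move=> l0; rewrite /mgamma_pdf; case: ifPn => [/forallP y0|]; last first.
  rewrite negb_forall => /existsP[j yj].
  rewrite eseries0 ?mule0// => k _ _; rewrite /mgamma_term (bigD1 j)//=.
  by rewrite /gamma_kernel (negbTE yj) !mul0r mulr0.
rewrite -mulrA EFinM; congr (_ * _)%E.
rewrite EFinM /hyp0F -nneseries_EFin; last first.
  by apply: is_cvg_series_hyp0F => //; apply: prodr_ge0 => j _; rewrite ltW.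
have P0 k := pochhammer_gt0 lambda k l0.
have G0 := Gamma_gt0 lambda l0.
rewrite -nneseriesZl; last first.
  move=> k _; rewrite lee_fin divr_ge0 ?mulr_ge0 ?exprn_ge0 ?ltW//.
  by apply: prodr_gt0.
apply: eq_eseriesr => k _; rewrite -EFinM; congr _%:E.
rewrite mulrCA mulrA mulrC; congr (_ * _).
rewrite -prodrXl -big_split/=; apply: eq_bigr => j _.
rewrite /gamma_kernel y0.
rewrite (_ : lambda + k%:R - 1 = lambda - 1 + k%:R); last by ring.
by rewrite [_ `^ (_ + k%:R)]gt0_powRD// powR_mulrn ?ltW//; ring.
Qed.

Lemma integral_mgamma_term {R : realType} {p : nat} (lambda : R)
    (b : 'I_p -> R) (k : nat) : (0 < p)%N -> 0 < lambda ->
  (forall j, 0 < b j) ->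
  (\int[lebesgue_tuple R p]_y (mgamma_term lambda b k y)%:E =
   ((\prod_j b j) `^ (- lambda))%:E *
   (pochhammer lambda k / k`!%:R * (\prod_j b j)^-1 ^+ k)%:E)%E.
Proof.
move=> p0 l0 b0.
have P0 := pochhammer_gt0 lambda k l0; have G0 := Gamma_gt0 lambda l0.
have B0 : 0 < \prod_j b j by apply: prodr_gt0.
pose g j t := gamma_kernel (lambda + k%:R) (b j) t / Gamma lambda.
have g0 j t : 0 <= g j t by rewrite divr_ge0 ?gamma_kernel_ge0 ?ltW.
have mg j : measurable_fun [set: R] (g j).
  by apply: measurable_funM => //; exact: measurable_gamma_kernel.
under eq_integral do rewrite /mgamma_term EFinM.
rewrite ge0_integralZl//=; last 3 first.
- by apply/measurable_EFinP; exact: (measurable_prod_tnth p g mg).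
- by move=> y _; rewrite lee_fin prodr_ge0// => j _; exact: g0.
- by rewrite lee_fin invr_ge0 mulr_ge0 ?exprn_ge0 ?ltW.
rewrite (integral_lebesgue_tuple_prod p g mg g0).
rewrite (eq_bigr (fun j =>
  (b j `^ (- (lambda + k%:R)) * pochhammer lambda k)%:E)); last first.
  move=> j _; rewrite /g; under eq_integral do rewrite EFinM.
  rewrite ge0_integralZr//=; last 3 first.
  - by apply/measurable_EFinP; exact: measurable_gamma_kernel.
  - by move=> t _; rewrite lee_fin gamma_kernel_ge0.
  - by rewrite lee_fin invr_ge0 ltW.
  rewrite integral_gamma_kernel ?ltr_wpDr// Gamma_pochhammer// -EFinM.
  by congr _%:E; field; rewrite gt_eqF.
rewrite prodEFin -!EFinM big_split/= prodr_const card_ord.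
rewrite prod_powR => [|j]; last exact: ltW.
rewrite opprD gt0_powRD// powR_invn ?ltW// exprVn.
have -> : pochhammer lambda k ^+ p =
    pochhammer lambda k * pochhammer lambda k ^+ p.-1.
  by rewrite -exprS prednK.
have fact0 : (k`!%:R : R) != 0 by rewrite pnatr_eq0 -lt0n fact_gt0.
congr _%:E; set u := (_ ^+ p.-1); set B := \prod_j _.
have u0 : u != 0 by rewrite expf_neq0 ?gt_eqF.
by field; rewrite fact0 u0 expf_neq0 ?gt_eqF.
Qed.

Lemma integral_mgamma_series {R : realType} {p : nat} (lambda : R)
    (b : 'I_p -> R) : (0 < p)%N -> 0 < lambda -> (forall j, 0 < b j) ->
  1 < \prod_j b j ->
  (\int[lebesgue_tuple R p]_y \sum_(0 <= k <oo) (mgamma_term lambda b k y)%:E =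
   ((\prod_j b j - 1) `^ (- lambda))%:E)%E.
Proof.
move=> p0 l0 b0; set B := \prod_j b j => B1.
have B0 : 0 < B by exact: lt_trans B1.
rewrite integral_nneseries//=; last 2 first.
- by move=> k; apply/measurable_EFinP; exact: measurable_mgamma_term.
- by move=> k y _; rewrite lee_fin mgamma_term_ge0.
under eq_eseriesr do rewrite integral_mgamma_term//.
rewrite nneseriesZl; last first.
  move=> k _; rewrite lee_fin mulr_ge0 ?exprn_ge0 ?invr_ge0 ?ltW//.
  by rewrite divr_gt0 ?pochhammer_gt0// ltr0n fact_gt0.
rewrite nneseries_binomial//; last by rewrite invr_ge0 ltW//= invf_lt1.
rewrite -EFinM -powRM ?subr_ge0 ?ltW// ?invf_lt1//.
by rewrite -/B; congr (_ `^ _)%:E; field; rewrite gt_eqF.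
Qed.

Lemma mgamma_pdf_ge0 {R : realType} {p : nat} (lambda : R) (b : 'I_p -> R)
    (y : p.-tuple R) : 0 < lambda -> 0 <= mgamma_pdf lambda b y.
Proof.
move=> l0; rewrite -lee_fin mgamma_pdf_series// mule_ge0 ?lee_fin ?powR_ge0//.
by apply: nneseries_ge0 => k _ _; rewrite lee_fin mgamma_term_ge0.
Qed.

Lemma measurable_mgamma_pdf {R : realType} {p : nat} (lambda : R)
    (b : 'I_p -> R) : 0 < lambda ->
  measurable_fun [set: p.-tuple R] (mgamma_pdf lambda b).
Proof.
move=> l0; apply/measurable_EFinP.
rewrite (_ : EFin \o _ = fun y => (((\prod_j b j - 1) `^ lambda)%:E *
    \sum_(0 <= k <oo) (mgamma_term lambda b k y)%:E)%E); last first.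
  by apply/funext => y /=; rewrite mgamma_pdf_series.
apply: measurable_funeM; apply: ge0_emeasurable_sum.
- by move=> k y _ _; rewrite lee_fin mgamma_term_ge0.
- by move=> k _; apply/measurable_EFinP; exact: measurable_mgamma_term.
Qed.

Lemma mgamma_laplace {R : realType} {p : nat} (lambda : R)
    (b eta : 'I_p -> R) : (0 < p)%N -> 0 < lambda ->
  (forall j, 0 < b j + eta j) -> 1 < \prod_j (b j + eta j) ->
  (\int[lebesgue_tuple R p]_y
     ((expR (- \sum_j eta j * tnth y j))%:E * (mgamma_pdf lambda b y)%:E) =
   ((\prod_j b j - 1) `^ lambda *
    (\prod_j (b j + eta j) - 1) `^ (- lambda))%:E)%E.
Proof.
move=> p0 l0 be0 be1.
pose be j := b j + eta j.
transitivity (\int[lebesgue_tuple R p]_y (((\prod_j b j - 1) `^ lambda)%:E *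
    \sum_(0 <= k <oo) (mgamma_term lambda be k y)%:E))%E.
  apply: eq_integral => y _; rewrite mgamma_pdf_series// muleCA.
  congr (_ * _)%E.
  rewrite -nneseriesZl; last by move=> k _; rewrite lee_fin mgamma_term_ge0.
  by apply: eq_eseriesr => k _; rewrite -EFinM expR_mgamma_term.
rewrite ge0_integralZl//=; last 3 first.
- apply: ge0_emeasurable_sum.
  + by move=> k y _ _; rewrite lee_fin mgamma_term_ge0.
  + by move=> k _; apply/measurable_EFinP; exact: measurable_mgamma_term.
- by move=> y _; apply: nneseries_ge0 => k _ _; rewrite lee_fin mgamma_term_ge0.
- by rewrite lee_fin powR_ge0.
by rewrite integral_mgamma_series// EFinM.
Qed.

(** Expanding prod_j (b_j + eta_j) over the set T of indices contributing
    eta_j gives the sum of b^(complement of T) eta^T; the T = set0 term is the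
    product of the b_j, and subtracting 1 from it leaves the coefficient 1 after
    division. *)
Lemma sum_mgamma_coef {R : realType} {p : nat} (b eta : 'I_p -> R) :
  \prod_j b j - 1 != 0 ->
  \sum_(T : {set 'I_p}) mgamma_coef b T * subset_prod eta T =
  (\prod_j (b j + eta j) - 1) / (\prod_j b j - 1).
Proof.
move=> B1.
have -> : \prod_j (b j + eta j) =
    \sum_(T : {set 'I_p}) subset_prod b (~: T)%SET * subset_prod eta T.
  under eq_bigr do rewrite addrC.
  rewrite bigA_distr; apply: eq_bigr => T _.
  rewrite (bigID (mem T))/= mulrC /subset_prod; congr (_ * _).
    by apply: eq_big => [j|j /negbTE ->]; rewrite ?finset.in_setC.
  by apply: eq_bigr => j ->.
rewrite (bigD1 finset.set0)//= [in RHS](bigD1 finset.set0)//=.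
have -> : subset_prod b (~: finset.set0)%SET = \prod_j b j.
  by apply: eq_bigl => j; rewrite finset.in_setC finset.in_set0.
have -> : subset_prod eta finset.set0 = 1 by rewrite /subset_prod big_set0.
rewrite {1}/mgamma_coef eqxx !mulr1 addrAC mulrDl divff//; congr (_ + _).
rewrite mulr_suml; apply: eq_bigr => T /negbTE T0.
by rewrite /mgamma_coef T0 mulrAC.
Qed.

(** The worst case is eta_j = - e for all j, and prod_j (b_j - e) is a
    polynomial in e, continuous at 0. *)
Lemma prod_gt1_perturb {R : realType} {p : nat} (b : 'I_p -> R) :
  (forall j, 0 < b j) -> 1 < \prod_j b j ->
  exists2 e : R, 0 < e & forall eta : 'I_p -> R, (forall j, `|eta j| < e) ->
    (forall j, 0 < b j + eta j) /\ 1 < \prod_j (b j + eta j).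
Proof.
move=> b0 B1.
pose P : {poly R} := \prod_j ((b j)%:P - 'X).
have P0 : P.[0] = \prod_j b j.
  by rewrite horner_prod; apply: eq_bigr => j _; rewrite !hornerE subr0.
have nearP : \forall e \near 0^'+, 1 < P.[e].
  apply: (cvgr_gt (P.[0])); last by rewrite P0.
  by apply: cvg_at_right_filter; exact: continuous_horner.
have nearb : \forall e \near 0^'+, forall j, e < b j.
  apply: filter_forall => j; exact: nbhs_right_lt.
have [e [e0 Pe be]] : exists e, [/\ 0 < e, 1 < P.[e] & forall j, e < b j].
  near (0 : R)^'+ => e; exists e; split; near: e => //.
  exact: nbhs_right_gt.
exists e => // eta eta_e.
have lee j : b j - e < b j + eta j.
  by have := eta_e j; rewrite ltr_norml ltrD2l => /andP[].
have bege0 j : 0 < b j - e by rewrite subr_gt0.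
split=> [j|]; first exact: lt_trans (lee j).
apply: (lt_le_trans Pe); rewrite horner_prod; apply: ler_prod => j _.
by rewrite !hornerE ltW//= ltW.
Unshelve. all: end_near. Qed.

Theorem proposition6p1 (R : realType) (p : nat) (lambda : R)
    (beta : 'I_p -> R) (p_ge2 : (2 <= p)%N) (lambda_gt0 : 0 < lambda)
    (beta_gt0 : forall j, 0 < beta j) (beta_star_gt1 : 1 < \prod_j beta j) :
  is_pdf (mgamma_pdf lambda beta) /\
  forall (d : measure_display) (Omega : measurableType d)
    (P : probability Omega R) (Y : {RV P >-> p.-tuple R}),
  has_pdf Y (mgamma_pdf lambda beta) ->
  exists2 e : R, 0 < e &
    (forall eta : 'I_p -> R, (forall j, `|eta j| < e) ->
      P.-integrable [set: Omega]
        (fun w => (expR (- \sum_j eta j * tnth (Y w) j))%:E)) /\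
    (forall eta : 'I_p -> R, (forall j, 0 < eta j < e) ->
      ('E_P [fun w => expR (- \sum_j eta j * tnth (Y w) j)] =
       ((\sum_(T : {set 'I_p}) mgamma_coef beta T * subset_prod eta T)
          `^ (- lambda))%:E)%E).
Proof.
have p_gt0 : (0 < p)%N by exact: leq_trans p_ge2.
have B1 : 0 < \prod_j beta j - 1 by rewrite subr_gt0.
split.
  split.
  - exact: measurable_mgamma_pdf.
  - by move=> y; exact: mgamma_pdf_ge0.
  - have beta0 : \prod_j (beta j + 0) = \prod_j beta j.
      by apply: eq_bigr => j _; rewrite addr0.
    (* 1 is the value at eta = 0 of the formula for the transform *)
    rewrite -[RHS]/(1%:E) -(powRr0 (\prod_j beta j - 1)) -(subrr lambda).
    rewrite gt0_powRD// -{2}beta0 -mgamma_laplace ?beta0// => [|j];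
      last by rewrite addr0.
    apply: eq_integral => y _.
    by rewrite big1 ?oppr0 ?expR0 ?mul1e// => j _; rewrite mul0r.
move=> d Omega P Y Ypdf.
have [e e0 eP] := prod_gt1_perturb beta beta_gt0 beta_star_gt1.
have mexp (eta : 'I_p -> R) : measurable_fun [set: p.-tuple R]
    (fun y => (expR (- \sum_j eta j * tnth y j))%:E).
  apply/measurable_EFinP; do 2 apply: measurableT_comp => //.
  apply: measurable_sum => j; apply: measurable_funM => //.
  exact: measurable_tnth.
have laplace (eta : 'I_p -> R) : (forall j, `|eta j| < e) ->
    (\int[P]_w (expR (- \sum_j eta j * tnth (Y w) j))%:E =
     ((\sum_(T : {set 'I_p}) mgamma_coef beta T * subset_prod eta T)
          `^ (- lambda))%:E)%E.
  move=> /eP[be0 be1].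
  transitivity (\int[distribution P Y]_y
      (expR (- \sum_j eta j * tnth y j))%:E)%E.
    by rewrite ge0_integral_distribution.
  rewrite (@ge0_integral_density _ _ _ (lebesgue_tuple R p) _
    (mgamma_pdf lambda beta))//.
  - rewrite mgamma_laplace// sum_mgamma_coef ?gt_eqF//.
    have E1 : 0 < \prod_j (beta j + eta j) - 1 by rewrite subr_gt0.
    congr _%:E; rewrite powRM ?invr_ge0 ?ltW//.
    by rewrite -(powR_inv1 (ltW B1)) -powRrM mulN1r opprK mulrC.
  - exact: measurable_mgamma_pdf.
  - by move=> y; exact: mgamma_pdf_ge0.
exists e => //; split => eta eta_e.
  apply/integrableP; split.
    exact: (measurableT_comp (mexp eta)).
  under eq_integral do rewrite gee0_abs ?lee_fin ?expR_ge0//.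
  by rewrite laplace// ltry.
rewrite unlock laplace// => j; have /andP[eta0 ?] := eta_e j.
by rewrite gtr0_norm.
Qed.
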